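(* Let $K=\mathbb{F}_q$ be a finite field, let $s\geq1$ and $d\leq s$ be integers, and let $\mathcal{C}_{\leq d}$ be the squarefree evaluation code of degree $d$ on the affine torus $T=(\mathbb{F}_q^* )^s$. If $q\geq 3$ and $d\geq 1$, then the second generalized Hamming weight of $\mathcal{C}_{\leq d}$ is $$ \delta_2(\mathcal{C}_{\leq d})= \begin{cases} (q-2)^{s-1}(q-1)&\mbox{ if }\, d=s,\\ (q-2)^d(q-1)^{s-d-1}q&\mbox{ if }\, d<s. \end{cases} $$
   Context: Let $S=K[t_1,\ldots,t_s]$, let $V_{\leq d}$ be the set of all squarefree monomials of $S$ of degree at most $d$ (including $1$), and let $KV_{\leq d}$ be its $K$-span. Write $T=\{P_1,\ldots,P_m\}$. The squarefree evaluation code $\mathcal{C}_{\leq d}\subset K^m$ of degree $d$ on $T$ is the image of $KV_{\leq d}\to K^m$, $f\mapsto(f(P_1),\ldots,f(P_m))$. For a linear code $C\subset K^m$ and $1\leq r\leq\dim_K C$, the $r$-th generalized Hamming weight is $\delta_r(C)=\min\{|\chi(D)| : D \text{ a linear subspace of } C,\ \dim_K D=r\}$, where $\chi(D)=\{i : \exists\,(a_1,\ldots,a_m)\in D,\ a_i\neq 0\}$. The convention $0^0=1$ is not needed since $q\geq3$. *)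

(* Defs.v *)
From HB Require Import structures.
From mathcomp Require Import all_boot all_order all_algebra.
From mathcomp Require Import mpoly.

Set Implicit Arguments.
Unset Strict Implicit.
Unset Printing Implicit Defensive.

Import GRing.Theory.
Local Open Scope ring_scope.

Section GeneralizedHammingWeights.

Variables (K : finFieldType) (m : nat).

Definition chi (D : {vspace 'rV[K]_m}) : {set 'I_m} :=
  [set i | [exists a : 'rV[K]_m, (a \in D) && (a 0 i != 0)]].

(* [is_ghw C r w] says that w is the minimum of #|chi D| over the
   r-dimensional subspaces D of C; it can only hold if r <= \dim C. *)
Definition is_ghw (C : {vspace 'rV[K]_m}) (r w : nat) : Prop :=
  (exists2 D : {vspace 'rV[K]_m}, (D <= C)%VS /\ \dim D = r & #|chi D| = w) /\
  (forall D : {vspace 'rV[K]_m}, (D <= C)%VS -> \dim D = r ->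
     (w <= #|chi D|)%N).

End GeneralizedHammingWeights.

Section SquarefreeEvaluationCodes.

Variables (K : finFieldType) (s : nat).

Definition torus : {set {ffun 'I_s -> K}} :=
  [set P : {ffun 'I_s -> K} | [forall i, P i != 0]].

Definition squarefree_exp (a : 'X_{1..s}) : bool := [forall i, (a i <= 1)%N].

(* The type 'X_{1..s < d.+1} consists of the exponents of total degree at
   most d. *)
Definition squarefree_monomials (d : nat) : seq {mpoly K[s]} :=
  [seq 'X_[bmnm a] | a : 'X_{1..s < d.+1} <- enum {: 'X_{1..s < d.+1}} & squarefree_exp a].

Definition in_squarefree_span (d : nat) (f : {mpoly K[s]}) : Prop :=
  exists c : 'X_{1..s < d.+1} -> K,
    f = \sum_(a | squarefree_exp (bmnm a)) c a *: 'X_[bmnm a].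

Definition torus_point (i : 'I_#|torus|) : {ffun 'I_s -> K} := enum_val i.

Definition evalT (f : {mpoly K[s]}) : 'rV[K]_#|torus| :=
  \row_i f.@[torus_point i].

(* Since {mpoly K[s]} is not finite-dimensional, the image of the span is
   written as the span of the images; see [squarefree_codeP]. *)
Definition squarefree_code (d : nat) : {vspace 'rV[K]_#|torus|} :=
  <<[seq evalT f | f <- squarefree_monomials d]>>%VS.

Lemma squarefree_codeP (d : nat) (v : 'rV[K]_#|torus|) :
  v \in squarefree_code d <->
  exists2 f : {mpoly K[s]}, in_squarefree_span d f & v = evalT f.
Proof.
have evE c : evalT (\sum_(a : 'X_{1..s < d.+1} | squarefree_exp (bmnm a))
                      c a *: 'X_[bmnm a])
   = \sum_(a : 'X_{1..s < d.+1} | squarefree_exp (bmnm a))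
       c a *: evalT 'X_[bmnm a].
  apply/rowP=> i; rewrite mxE raddf_sum summxE /=.
  by apply: eq_bigr => a _; rewrite mevalZ !mxE.
have codeE : squarefree_code d =
    (\sum_(a : 'X_{1..s < d.+1} | squarefree_exp (bmnm a))
        <[evalT 'X_[bmnm a]]>)%VS.
  by rewrite /squarefree_code span_def !big_map big_filter big_enum_cond.
rewrite codeE; split.
- case/memv_sumP=> w w_in ->.
  pose t (a : 'X_{1..s < d.+1}) := evalT 'X_[bmnm a].
  have /fin_all_exists[c cE] a :
      exists k, squarefree_exp (bmnm a) -> w a = k *: t a.
    have [sq|nsq] := boolP (squarefree_exp (bmnm a)); last by exists 0.
    by have /vlineP[k ->] := w_in _ sq; exists k.
  eexists; first by exists c.
  by rewrite evE; apply: eq_bigr => a; apply: cE.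
- case=> _ [c ->] ->; rewrite evE; apply: memv_sumr => a _.
  by rewrite memvZ ?memv_line.
Qed.

End SquarefreeEvaluationCodes.

(* Main.v *)
Require Import Defs.
From mathcomp Require Import all_boot all_order all_algebra.
From mathcomp Require Import mpoly zify.

(** Let a = q - 1. A squarefree polynomial is affine in each variable,
    f = g + t_i h with g, h free of t_i and deg h < deg f; counting zeros along
    the lines in direction i gives a |supp f| >= (a - 1) |supp h|, whence by
    induction a^d |supp f| >= (a - 1)^d a^s if f <> 0 has degree at most d.
    For independent f1, f2 pick i such that h1, h2 are not both 0. If h1, h2 are
    independent, a |supp (f1, f2)| >= (a - 1) |supp (h1, h2)| and one
    inducts. Otherwise a change of basis makes h2 = 0 and h1 <> 0, so that
    a |supp (f1, f2)| >= (a - 1) |supp h1| + |supp f2|, and the bound for a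
    single polynomial applies. The induction is on d for d < s, and on the
    number of variables for d = s, where |supp (f1, f2)| >= |supp f2| suffices.
    All counts are made over the whole torus, whatever variables occur, so that
    the bounds are statements about densities.
    Equality: multiply t_a - 1 and t_b - 1 (or t_a - 1 and t_a - x when d = s)
    by d - 1 factors t_j - 1 in other variables. *)

(** * Squarefree polynomials as coefficient families: derivatives, independence, change of basis *)

Section MultiaffineFunctions.

Set Implicit Arguments.
Unset Strict Implicit.
Unset Printing Implicit Defensive.
Import GRing.Theory.
Local Open Scope ring_scope.

Variables (K : finFieldType) (n : nat).
Implicit Types (c : {ffun {set 'I_n} -> K}) (P : {ffun 'I_n -> K}).

(* [c A] is the coefficient of the squarefree monomial with variables in A. *)
Definition sqf_eval c P : K := \sum_A c A * \prod_(i in A) P i.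

(** In f = g + t_i h, [sqf_deriv i c] is h, the formal partial derivative, and [sqf_const i c] is
    g. *)
Definition sqf_deriv i c : {ffun {set 'I_n} -> K} :=
  [ffun A : {set 'I_n} => if i \in A then 0 else c (i |: A)].

Definition sqf_const i c : {ffun {set 'I_n} -> K} :=
  [ffun A : {set 'I_n} => if i \in A then 0 else c A].

Definition upd P i t : {ffun 'I_n -> K} :=
  [ffun j => if j == i then t else P j].

Definition comb (x y : K) c1 c2 : {ffun {set 'I_n} -> K} :=
  [ffun A => x * c1 A + y * c2 A].

(** Independence of coefficients, not of functions on the torus: this is the form that passes to
    derivatives. *)
Definition indep c1 c2 :=
  forall x y : K, comb x y c1 c2 = 0 -> x = 0 /\ y = 0.

Definition supp c := [set P in torus K n | sqf_eval c P != 0].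

Definition supp2 c1 c2 :=
  [set P in torus K n | (sqf_eval c1 P != 0) || (sqf_eval c2 P != 0)].

Definition degree_le d c := forall A, c A != 0 -> (#|A| <= d)%N.

Definition vars_in (V : {set 'I_n}) c := forall A, c A != 0 -> A \subset V.

Lemma sqf_eval_lin x y c1 c2 P :
  sqf_eval (comb x y c1 c2) P = x * sqf_eval c1 P + y * sqf_eval c2 P.
Proof.
rewrite /sqf_eval !mulr_sumr -big_split; apply: eq_bigr => A _ /=.
by rewrite !ffunE mulrDl -!mulrA.
Qed.

Lemma comb10 c1 c2 : comb 1 0 c1 c2 = c1.
Proof. by apply/ffunP => A; rewrite ffunE mul1r mul0r addr0. Qed.

Lemma comb01 c1 c2 : comb 0 1 c1 c2 = c2.
Proof. by apply/ffunP => A; rewrite ffunE mul1r mul0r add0r. Qed.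

Lemma sqf_deriv_lin i x y c1 c2 :
  sqf_deriv i (comb x y c1 c2) = comb x y (sqf_deriv i c1) (sqf_deriv i c2).
Proof.
apply/ffunP => A; rewrite !ffunE; case: ifP => // _.
by rewrite !mulr0 addr0.
Qed.

Lemma sqf_eval_split i c P :
  sqf_eval c P = sqf_eval (sqf_const i c) P + P i * sqf_eval (sqf_deriv i c) P.
Proof.
rewrite /sqf_eval (bigID (fun A : {set _} => i \in A)) /= addrC; congr (_ + _).
  rewrite [RHS](bigID (fun A : {set _} => i \in A)) /= [X in _ = X + _]big1 ?add0r.
    by apply: eq_bigr => A /negPf iA; rewrite ffunE iA.
  by move=> A iA; rewrite ffunE iA mul0r.
rewrite mulr_sumr [RHS](bigID (fun A : {set _} => i \in A)) /= [X in _ = X + _]big1 ?add0r.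
  (* Monomials containing t_i correspond to those free of it through division by t_i. *)
  rewrite (reindex_onto (fun A => i |: A) (fun A => A :\ i)) /=; last first.
    by move=> A iA; rewrite setD1K.
  apply: eq_big => A.
    rewrite setU11 /=; apply/eqP/idP => [<-|iA]; first by rewrite !inE eqxx.
    by rewrite setU1K.
  case/andP=> _ /eqP AE; have iA : i \notin A by rewrite -AE !inE eqxx.
  by rewrite ffunE (negPf iA) big_setU1 //= mulrCA.
by move=> A iA; rewrite ffunE iA mul0r mulr0.
Qed.

Lemma sqf_eval_upd i t c P :
  (forall A, c A != 0 -> i \notin A) -> sqf_eval c (upd P i t) = sqf_eval c P.
Proof.
move=> ci; apply: eq_bigr => A _.
have [->|/ci iA] := eqVneq (c A) 0; first by rewrite !mul0r.
congr (_ * _); apply: eq_bigr => j jA; rewrite ffunE; case: eqP => // ji.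
by rewrite -ji jA in iA.
Qed.

Lemma sqf_eval_line i t c P :
  sqf_eval c (upd P i t) =
  sqf_eval (sqf_const i c) P + t * sqf_eval (sqf_deriv i c) P.
Proof.
rewrite (sqf_eval_split i) ffunE eqxx !sqf_eval_upd //.
  by move=> A; rewrite ffunE; case: (i \in A) => //; rewrite eqxx.
by move=> A; rewrite ffunE; case: (i \in A) => //; rewrite eqxx.
Qed.

Lemma sqf_deriv_eq0 i c : sqf_deriv i c = 0 -> forall A, c A != 0 -> i \notin A.
Proof.
move=> /ffunP h A cA; apply/negP => iA; have := h (A :\ i).
by rewrite !ffunE !inE eqxx setD1K //= => cA0; rewrite cA0 eqxx in cA.
Qed.

Lemma degree_le_deriv i d c : degree_le d.+1 c -> degree_le d (sqf_deriv i c).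
Proof.
move=> h A; rewrite ffunE; case: ifPn => [|iA /h]; first by rewrite eqxx.
by rewrite cardsU1 iA.
Qed.

Lemma degree_le_lin d x y c1 c2 :
  degree_le d c1 -> degree_le d c2 -> degree_le d (comb x y c1 c2).
Proof.
move=> h1 h2 A; rewrite !ffunE.
have [->|/h1 //] := eqVneq (c1 A) 0; have [->|/h2 //] := eqVneq (c2 A) 0.
by rewrite !mulr0 addr0 eqxx.
Qed.

Lemma vars_in_lin V x y c1 c2 :
  vars_in V c1 -> vars_in V c2 -> vars_in V (comb x y c1 c2).
Proof.
move=> h1 h2 A; rewrite !ffunE.
have [->|/h1 //] := eqVneq (c1 A) 0; have [->|/h2 //] := eqVneq (c2 A) 0.
by rewrite !mulr0 addr0 eqxx.
Qed.

Lemma vars_in_deriv i V c : vars_in V c -> vars_in (V :\ i) (sqf_deriv i c).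
Proof.
move=> h A; rewrite ffunE; case: ifPn => [|iA /h]; first by rewrite eqxx.
by rewrite subUset subsetD1 iA andbT => /andP[].
Qed.

Lemma deriv_vars_in i V c : vars_in V c -> sqf_deriv i c != 0 -> i \in V.
Proof.
move=> cV; apply: contraNT => iV; apply/eqP/ffunP => A; rewrite !ffunE.
case: ifPn => // iA; apply: contraNeq iV => /cV.
by rewrite subUset sub1set => /andP[].
Qed.

Lemma sqf_deriv_const c :
  (forall i, sqf_deriv i c = 0) -> forall A, A != set0 -> c A = 0.
Proof.
move=> h A /set0Pn[i iA]; apply/eqP; apply: contraLR iA => cA.
exact: sqf_deriv_eq0 (h i) _ cA.
Qed.

(** If all derivatives vanished, both polynomials would be constants, and two constants are always
    dependent. *)
Lemma indep_deriv c1 c2 : indep c1 c2 ->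
  exists i, (sqf_deriv i c1 != 0) || (sqf_deriv i c2 != 0).
Proof.
move=> ind; apply/existsP; apply: contraT; rewrite negb_exists => /forallP h.
have h1 i : sqf_deriv i c1 = 0 by have := h i; rewrite negb_or !negbK => /andP[/eqP].
have h2 i : sqf_deriv i c2 = 0 by have := h i; rewrite negb_or !negbK => /andP[_ /eqP].
have [] := ind (c2 set0) (- c1 set0).
  apply/ffunP => A; rewrite !ffunE.
  have [->|A0] := eqVneq A set0; first by rewrite mulrC mulNr subrr.
  by rewrite (sqf_deriv_const h1 A0) (sqf_deriv_const h2 A0) !mulr0 addr0.
move=> c20 /eqP; rewrite oppr_eq0 => /eqP c10.
have c1E : c1 = 0.
  apply/ffunP => A; rewrite ffunE.
  by have [->|/(sqf_deriv_const h1)] := eqVneq A set0.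
have [] := ind 1 0; first by apply/ffunP => A; rewrite c1E !ffunE mulr0 mul0r addr0.
by move/eqP; rewrite oner_eq0.
Qed.

Lemma supp2_lin x y z t c1 c2 :
  supp2 (comb x y c1 c2) (comb z t c1 c2) \subset supp2 c1 c2.
Proof.
apply/subsetP => P; rewrite !inE !sqf_eval_lin => /andP[-> /=].
have [->|//] := eqVneq (sqf_eval c1 P) 0; have [->|//] := eqVneq (sqf_eval c2 P) 0.
by rewrite !mulr0 !addr0 eqxx.
Qed.

(* Basis change making the second element independent of the variable i when
   the two derivatives in direction i are proportional. *)
Lemma indep_split c1 c2 i : indep c1 c2 ->
    (sqf_deriv i c1 != 0) || (sqf_deriv i c2 != 0) ->
    indep (sqf_deriv i c1) (sqf_deriv i c2) \/
  exists x y z t : K, [/\ sqf_deriv i (comb x y c1 c2) != 0,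
     sqf_deriv i (comb z t c1 c2) = 0 & comb z t c1 c2 != 0].
Proof.
move=> ind nz.
have [/existsP[x /existsP[y /andP[/eqP h xy]]]|] := boolP [exists x, exists y,
  (comb x y (sqf_deriv i c1) (sqf_deriv i c2) == 0) && ((x != 0) || (y != 0))].
  (* The first combination is whichever of [c1], [c2] has a nonzero derivative; the second uses the
     relation found between the derivatives. *)
  right; exists (sqf_deriv i c1 != 0)%:R, (sqf_deriv i c1 == 0)%:R, x, y; split.
  - rewrite sqf_deriv_lin.
    by have [d1|d1] := eqVneq (sqf_deriv i c1) 0;
      rewrite ?comb10 ?comb01 //; rewrite d1 eqxx in nz.
  - by rewrite sqf_deriv_lin.
  - by apply/eqP => /ind[x0 y0]; rewrite x0 y0 eqxx in xy.
rewrite negb_exists => /forallP h; left => x y xy0.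
have := h x; rewrite negb_exists => /forallP/(_ y).
by rewrite xy0 eqxx /= negb_or !negbK => /andP[/eqP -> /eqP ->].
Qed.

End MultiaffineFunctions.

(** * Counting on the torus along coordinate lines *)

Section Counting.

Set Implicit Arguments.
Unset Strict Implicit.
Unset Printing Implicit Defensive.
Import GRing.Theory.
Local Open Scope ring_scope.

Variables (K : finFieldType) (n m : nat).
(** Thus [m] is q - 2 and there are [m.+1] units; bounds are stated multiplicatively, without
    division. *)
Hypothesis cardK : #|K| = m.+2.
Implicit Types (c : {ffun {set 'I_n} -> K}) (P : {ffun 'I_n -> K}).

Lemma card_nz : #|[pred t : K | t != 0]| = m.+1.
Proof. by rewrite -[RHS]/(m.+2.-1) -cardK -(cardC1 (0 : K)). Qed.

Lemma card_torus : #|torus K n| = (m.+1 ^ n)%N.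
Proof.
rewrite -card_nz -[in RHS](card_ord n) -card_ffun_on; apply: eq_card => P.
by rewrite inE; apply/forallP/ffun_onP.
Qed.

Lemma upd_torus P i t : P \in torus K n -> t != 0 -> upd P i t \in torus K n.
Proof.
rewrite !inE => /forallP h t0; apply/forallP => j; rewrite ffunE.
by case: ifP.
Qed.

Lemma torus_line_sum i (phi : {ffun 'I_n -> K} -> nat) :
  (\sum_(P in torus K n) \sum_(t | t != 0%R) phi (upd P i t)
   = m.+1 * \sum_(P in torus K n) phi P)%N.
Proof.
(* Swapping the coordinate i of P with t is an involution of the pairs (P, t), and it turns
   [phi (upd P i t)] into [phi P]. *)
pose h (x : {ffun 'I_n -> K} * K) := (upd x.1 i x.2, x.1 i).
have hh : involutive h.
  case=> P t; rewrite /h /= ffunE eqxx; congr (_, _); apply/ffunP => j.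
  by rewrite !ffunE; case: eqP => [->|].
have hT x : (x.1 \in torus K n) && (x.2 != 0) ->
            ((h x).1 \in torus K n) && ((h x).2 != 0).
  case: x => P t /= /andP[PT t0]; rewrite upd_torus //=.
  by move: PT; rewrite inE => /forallP.
rewrite pair_big_dep /= (reindex_inj (inv_inj hh)) /=.
rewrite (eq_big (fun x => (x.1 \in torus K n) && (x.2 != 0)) (fun x => phi x.1)).
- rewrite -(pair_big_dep (mem (torus K n)) (fun _ t => t != 0) (fun P _ => phi P)).
  rewrite big_distrr /=; apply: eq_bigr => P _.
  by rewrite sum_nat_const card_nz.
- by move=> x; apply/idP/idP => [/(hT (h x))|/hT //]; rewrite hh.
- by move=> x _; congr phi; exact: (congr1 fst (hh x)).
Qed.

Lemma card_torus_sum (p : pred {ffun 'I_n -> K}) :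
  (#|[set P in torus K n | p P]| = \sum_(P in torus K n) p P)%N.
Proof.
rewrite -sum1_card [RHS](eq_bigr (fun P => if p P then 1 else 0)%N).
  by rewrite -big_mkcondr /=; apply: eq_bigl => P; rewrite !inE.
by move=> P _; case: (p P).
Qed.

(** For h nonzero, at most one of the [m.+1] units is the root -g/h. *)
Lemma card_affine_root (g h : K) :
  (m * (h != 0)%R <= \sum_(t | t != 0%R) (g + t * h != 0)%R)%N.
Proof.
have [->|h0] := eqVneq h 0; first by rewrite muln0.
rewrite muln1 -ltnS -card_nz -sum1_card.
rewrite (eq_bigr (fun t => (g + t * h != 0)%R + (g + t * h == 0)%R)%N); last first.
  by move=> t _; case: eqP.
rewrite big_split /= -addn1 leq_add2l.
apply: (@leq_trans (\sum_(t : K) (t == - (g / h))%R)%N).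
  rewrite big_mkcond /=; apply: leq_sum => t _; case: ifP => // _.
  case: eqP => // gt; suff -> : t = - (g / h) by rewrite eqxx.
  by apply: (mulIf h0); rewrite mulNr divfK //; apply/eqP; rewrite -addr_eq0 addrC gt.
by rewrite (bigD1 (- (g / h))) //= eqxx big1 // => t /negPf ->.
Qed.

Lemma supp_deriv i c : (m * #|supp (sqf_deriv i c)| <= m.+1 * #|supp c|)%N.
Proof.
rewrite !card_torus_sum -(torus_line_sum i) big_distrr /=; apply: leq_sum => P _.
by under eq_bigr => t _ do rewrite sqf_eval_line; exact: card_affine_root.
Qed.

Lemma supp2_deriv i c1 c2 :
  (m * #|supp2 (sqf_deriv i c1) (sqf_deriv i c2)| <= m.+1 * #|supp2 c1 c2|)%N.
Proof.
rewrite !card_torus_sum -(torus_line_sum i) big_distrr /=; apply: leq_sum => P _.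
under eq_bigr => t _ do rewrite !sqf_eval_line.
have := card_affine_root (sqf_eval (sqf_const i c1) P) (sqf_eval (sqf_deriv i c1) P).
have := card_affine_root (sqf_eval (sqf_const i c2) P) (sqf_eval (sqf_deriv i c2) P).
case: (sqf_eval (sqf_deriv i c1) P != 0) => /=.
  move=> _ h; apply: leq_trans h _; apply: leq_sum => t _.
  by case: (_ != 0).
move=> h _; apply: leq_trans h _; apply: leq_sum => t _.
by case: (_ != 0); case: (_ != 0).
Qed.

(** [c2] is constant on each line in direction i. Where it is nonzero the whole line, [m.+1] points,
    is counted; elsewhere [c1] alone gives [m] points if its derivative is nonzero. *)
Lemma supp2_deriv0 i c1 c2 : sqf_deriv i c2 = 0 ->
  (m * #|supp (sqf_deriv i c1)| + #|supp c2| <= m.+1 * #|supp2 c1 c2|)%N.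
Proof.
move=> d2; rewrite !card_torus_sum -(torus_line_sum i) big_distrr /=.
rewrite -big_split /=; apply: leq_sum => P _.
have e2 t : sqf_eval c2 (upd P i t) = sqf_eval c2 P.
  exact/sqf_eval_upd/sqf_deriv_eq0.
under eq_bigr => t _ do rewrite e2 sqf_eval_line.
case: (sqf_eval c2 P != 0) => /=.
  under eq_bigr => t _ do rewrite orbT.
  by rewrite sum_nat_const card_nz muln1; case: (_ != 0); rewrite ?muln1 ?muln0 addn1.
rewrite addn0; under eq_bigr => t _ do rewrite orbF.
exact: card_affine_root.
Qed.

(** * Lower bounds for the supports of one polynomial and of an independent pair *)

Lemma leq_mul_chain a b k x y z :
  (x <= k * y -> a * y <= b * z -> a * x <= b * k * z)%N.
Proof.
move=> xy yz; apply: (@leq_trans (a * (k * y))); first by rewrite leq_mul2l xy orbT.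
by rewrite mulnCA (mulnC b) -mulnA leq_mul2l yz orbT.
Qed.

Lemma supp_lb d c : degree_le d c -> c != 0 ->
  (m ^ d * m.+1 ^ n <= m.+1 ^ d * #|supp c|)%N.
Proof.
elim: d c => [|d IH] c cd c0.
  have -> : supp c = torus K n.
    apply/setP => P; rewrite in_set andb_idr // => _.
    have cE A : A != set0 -> c A = 0.
      by move=> A0; apply: contraNeq A0 => /cd; rewrite leqn0 cards_eq0.
    rewrite /sqf_eval (bigD1 set0) //= big_set0 mulr1 big1 ?addr0.
      apply: contraNneq c0 => c0; apply/eqP/ffunP => A; rewrite ffunE.
      by have [->|/cE] := eqVneq A set0.
    by move=> A A0; rewrite cE // mul0r.
  by rewrite card_torus !expn0 !mul1n.
have [/existsP[i di]|] := boolP [exists i, sqf_deriv i c != 0].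
  have := IH _ (degree_le_deriv cd) di.
  by move/leq_mul_chain/(_ (supp_deriv i c)); rewrite !expnS !mulnA.
(* Otherwise [c] is a nonzero constant, so the bound for degree d applies to it and is the stronger
   one. *)
rewrite negb_exists => /forallP h.
have /IH/(_ c0) : degree_le d c.
  move=> A cA; have [->|A0] := eqVneq A set0; first by rewrite cards0.
  have dc i : sqf_deriv i c = 0 by apply/eqP; have := h i; rewrite negbK.
  by rewrite (sqf_deriv_const dc) ?eqxx in cA.
rewrite !expnS; nia.
Qed.

Lemma supp2_sub_r c1 c2 : (#|supp c2| <= #|supp2 c1 c2|)%N.
Proof.
by apply/subset_leq_card/subsetP => P; rewrite !inE => /andP[-> ->]; rewrite orbT.
Qed.

Lemma supp2_lb_degree d c1 c2 : degree_le d c1 -> degree_le d c2 ->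
  indep c1 c2 ->
  (m ^ d * m.+2 * m.+1 ^ n <= m.+1 ^ d.+1 * #|supp2 c1 c2|)%N.
Proof.
elim: d c1 c2 => [|d IH] c1 c2 c1d c2d ind.
  have d0 i c : degree_le 0 c -> sqf_deriv i c = 0.
    move=> cd; apply/ffunP => A; rewrite !ffunE; case: ifPn => // iA.
    by apply: contraTeq isT => /cd; rewrite cardsU1 iA.
  by have [i] := indep_deriv ind; rewrite !d0 ?eqxx.
have [i di] := indep_deriv ind.
have [ind'|[x [y [z [t [d1 d2 nz]]]]]] := indep_split ind di.
  have := IH _ _ (degree_le_deriv c1d) (degree_le_deriv c2d) ind'.
  by move/leq_mul_chain/(_ (supp2_deriv i c1 c2)); rewrite !expnS !mulnA.
(* Proportional derivatives: the single-polynomial bounds have degree d for the derivative and d + 1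
   for the combination free of t_i. Their densities add up with weights m and 1, and 1 + 1/(m+1) =
   (m+2)/(m+1) produces the factor q. *)
have := subset_leq_card (supp2_lin x y z t c1 c2).
have := supp2_deriv0 (comb x y c1 c2) d2.
have := supp_lb (degree_le_deriv (degree_le_lin c1d c2d)) d1.
have := supp_lb (degree_le_lin c1d c2d) nz.
rewrite !expnS.
set M := (m ^ d)%N; set M' := (m.+1 ^ d)%N; set T := (m.+1 ^ n)%N.
set X := #|supp (comb _ _ _ _)|; set Y := #|supp _|; set N' := #|_|; set N := #|_|.
move=> hX hY hN NN.
have h1 : (m.+1 * M' * (m * Y + X) <= m.+1 * M' * (m.+1 * N))%N.
  by rewrite leq_mul2l (leq_trans hN) ?orbT // leq_mul2l NN orbT.
have h2 : (m.+1 * m * (M * T) <= m.+1 * m * (M' * Y))%N by rewrite leq_mul2l hY orbT.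
nia.
Qed.

(** With all variables allowed, this beats the degree bound at d = n, because (m+1)^2 > m(m+2). *)
Lemma supp2_lb_vars v (V : {set 'I_n}) c1 c2 : (#|V| <= v.+1)%N ->
  vars_in V c1 -> vars_in V c2 -> indep c1 c2 ->
  (m ^ v * m.+1 ^ n <= m.+1 ^ v * #|supp2 c1 c2|)%N.
Proof.
(* A combination free of t_i involves at most [k] variables, hence has degree at most [k], and its
   support alone suffices. *)
have bound_indep_var i k (W : {set 'I_n}) (e1 e2 : {ffun {set 'I_n} -> K}) z t :
    (#|W :\ i| <= k)%N ->
    vars_in W e1 -> vars_in W e2 -> sqf_deriv i (comb z t e1 e2) = 0 ->
    comb z t e1 e2 != 0 -> (m ^ k * m.+1 ^ n <= m.+1 ^ k * #|supp2 e1 e2|)%N.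
  move=> Wk e1W e2W d0 nz.
  have deg : degree_le k (comb z t e1 e2).
    move=> A cA; apply: leq_trans Wk; rewrite subset_leq_card // subsetD1.
    by rewrite (vars_in_lin e1W e2W cA) (sqf_deriv_eq0 d0).
  apply: leq_trans (supp_lb deg nz) _; rewrite leq_mul2l.
  (* The zero combination is a dummy first member that brings the pair into the form of
     [supp2_lin]. *)
  rewrite (leq_trans (supp2_sub_r (comb 0 0 e1 e2) _)) ?orbT //.
  exact/subset_leq_card/supp2_lin.
elim: v V c1 c2 => [|v IH] V c1 c2 Vv c1V c2V ind; have [i di] := indep_deriv ind;
  have iV : i \in V by [case/orP: di; apply: deriv_vars_in];
  move: Vv; rewrite (cardsD1 i) iV add1n ltnS => Vv;
  have [ind'|[x [y [z [t [_ d2 nz]]]]]] := indep_split ind di.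
(* With one variable the derivatives are constants, so they cannot be independent. *)
- have [j] := indep_deriv ind'; move: Vv; rewrite leqn0 cards_eq0 => /eqP V0.
  by case/orP => dj; [have := deriv_vars_in (vars_in_deriv c1V) dj
    | have := deriv_vars_in (vars_in_deriv c2V) dj]; rewrite V0 inE.
- exact: (bound_indep_var _ _ _ _ _ _ _ Vv c1V c2V d2 nz).
- have := IH _ _ _ Vv (vars_in_deriv c1V) (vars_in_deriv c2V) ind'.
  by move/leq_mul_chain/(_ (supp2_deriv i c1 c2)); rewrite !expnS !mulnA.
- exact: (bound_indep_var _ _ _ _ _ _ _ Vv c1V c2V d2 nz).
Qed.

(** A product set: [m] choices for a coordinate in [B], one in [C], and [m.+1] elsewhere. *)
Lemma card_grid (B C : {set 'I_n}) (y : 'I_n -> K) :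
  [disjoint B & C] -> (forall j, y j != 0) ->
  #|[set P in torus K n | [forall (j | j \in B), P j != y j]
                         && [forall (j | j \in C), P j == y j]]|
  = (m ^ #|B| * m.+1 ^ #|~: (B :|: C)|)%N.
Proof.
move=> BC y0.
pose F j := [pred t : K | [&& t != 0, (j \in B) ==> (t != y j)
                              & (j \in C) ==> (t == y j)]].
have -> : #|[set P in torus K n | [forall (j | j \in B), P j != y j]
                         && [forall (j | j \in C), P j == y j]]| = #|family F|.
  apply: eq_card => P; rewrite !inE.
  apply/and3P/familyP => [[/forallP h0 /forallP hB /forallP hC] j|h].
    by rewrite inE h0 hB hC.
  by split; apply/forallP => j; have /and3P[] := h j.
rewrite card_family foldrE big_image /= (bigID (mem B)) /=; congr (_ * _)%N.
  rewrite -prod_nat_const; apply: eq_bigr => j jB.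
  have -> : #|F j| = #|[predD1 [pred t : K | t != 0] & y j]|.
    apply: eq_card => t; rewrite !inE jB (disjointFr BC jB) /= andbT.
    by rewrite andbC.
  by have := cardD1 (y j) [pred t : K | t != 0]; rewrite card_nz inE y0 => -[].
rewrite (bigID (mem C)) /= big1 ?mul1n => [|j /andP[jB jC]]; last first.
  rewrite (eq_card (B := pred1 (y j))) ?card1 // => t; rewrite -[LHS]/(F j t) /= (negPf jB) jC.
  by rewrite inE /=; case: (eqVneq t (y j)) => [->|_]; rewrite ?andbF ?y0.
rewrite -prod_nat_const; apply: eq_big => j; first by rewrite !inE negb_or.
case/andP=> jB jC; rewrite -card_nz; apply: eq_card => t.
by rewrite -[LHS]/(F j t) /= (negPf jB) (negPf jC) andbT.
Qed.

End Counting.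

(** * From codewords to coefficient families and back *)

Section Codes.

Set Implicit Arguments.
Unset Strict Implicit.
Unset Printing Implicit Defensive.
Import GRing.Theory.
Local Open Scope ring_scope.

Variables (K : finFieldType) (n : nat).
Implicit Types (c : {ffun {set 'I_n} -> K}) (P : {ffun 'I_n -> K}).

Lemma squarefree_code_eval d v : v \in squarefree_code K n d ->
  exists2 c, degree_le d c & v = \row_i sqf_eval c (torus_point i).
Proof.
case/squarefree_codeP => _ [k ->] ->.
pose sp (a : 'X_{1..n < d.+1}) := [set j | bmnm a j != 0%N].
(* A squarefree exponent is determined by its support, so the sum has at most one term; it spares an
   explicit inverse of [sp]. *)
exists [ffun A => \sum_(a | squarefree_exp (bmnm a) && (sp a == A)) k a].
  move=> A; rewrite ffunE => /eqP nz.
  have [a /andP[_ /eqP <-]|none] := pickP [pred a | squarefree_exp (bmnm a) && (sp a == A)].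
    rewrite -ltnS; apply: leq_ltn_trans (bmdeg a).
    rewrite mdegE -sum1_card big_mkcond /=; apply: leq_sum => j _.
    by rewrite inE; case: (bmnm a j).
  by case: nz; rewrite big_pred0.
apply/rowP => i; rewrite !mxE raddf_sum /=.
rewrite (partition_big sp predT) //=; apply: eq_bigr => A _.
rewrite ffunE mulr_suml; apply: eq_bigr => a /andP[/forallP sq /eqP <-].
rewrite mevalZ mevalX [in RHS]big_mkcond; congr (_ * _); apply: eq_bigr => j _.
by rewrite inE; have := sq j; case: (bmnm a j) => [|[]].
Qed.

Lemma monomial_in_code d (A : {set 'I_n}) : (#|A| <= d)%N ->
  \row_i \prod_(j in A) torus_point i j \in squarefree_code K n d.
Proof.
move=> Ad; pose a0 := [multinom (j \in A : nat) | j < n]%MM.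
have a0d : (mdeg a0 < d.+1)%N.
  rewrite ltnS mdegE (leq_trans _ Ad) // -sum1_card [leqRHS]big_mkcond.
  by apply: leq_sum => j _; rewrite mnmE; case: (j \in A).
apply/squarefree_codeP; exists 'X_[a0].
  exists (fun a => (a == BMultinom a0d)%:R).
  rewrite (bigD1 (BMultinom a0d)) /=; last by apply/forallP => j; rewrite mnmE leq_b1.
  by rewrite eqxx scale1r big1 ?addr0 // => a /andP[_ /negPf ->]; rewrite scale0r.
apply/rowP => i; rewrite !mxE mevalX big_mkcond; apply: eq_bigr => j _.
by rewrite mnmE; case: (j \in A).
Qed.

(** * Products of linear factors, and planes in the code *)

Definition shifted_prod (B : {set 'I_n}) (y : 'I_n -> K) P : K :=
  \prod_(j in B) (P j - y j).

Lemma shifted_prod_neq0 B y P :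
  (shifted_prod B y P != 0) = [forall (j | j \in B), P j != y j].
Proof.
apply/prodf_neq0/forall_inP => h j /h; by rewrite subr_eq0.
Qed.

Lemma shifted_prod_in_code d (B : {set 'I_n}) y : (#|B| <= d)%N ->
  \row_i shifted_prod B y (torus_point i) \in squarefree_code K n d.
Proof.
move=> Bd.
have E P : shifted_prod B y P = \sum_(J : {set 'I_n} | J \subset B)
    (\prod_(j | j \notin J) (if j \in B then - y j else 1)) * \prod_(j in J) P j.
  rewrite /shifted_prod big_mkcond /=.
  (* A factor outside [B] is written 0 + 1, so that the product expands over all subsets J; those
     not inside [B] contribute 0. *)
  rewrite (eq_bigr (fun j => (if j \in B then P j else 0) +
      (if j \in B then - y j else 1))); last by move=> j _; case: ifP; rewrite ?add0r.
  rewrite bigA_distr [RHS]big_mkcond; apply: eq_bigr => J _ /=.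
  rewrite (bigID (mem J)) /= mulrC.
  rewrite (eq_bigr (fun j => if j \in B then - y j else 1)); last first.
    by move=> j /negPf ->.
  case: ifPn => [/subsetP JB|/subsetPn[j jJ jB]].
    by congr (_ * _); apply: eq_bigr => j jJ; rewrite jJ JB.
  by rewrite [X in _ * X](bigD1 j) //= jJ (negPf jB) mul0r mulr0.
have -> : \row_i shifted_prod B y (torus_point i) = \sum_(J : {set 'I_n} | J \subset B)
    (\prod_(j | j \notin J) (if j \in B then - y j else 1)) *:
       \row_i \prod_(j in J) torus_point i j.
  by apply/rowP => i; rewrite mxE E summxE; apply: eq_bigr => J _; rewrite !mxE.
apply: memv_suml => J JB; apply/memvZ/monomial_in_code.
exact: leq_trans (subset_leq_card JB) Bd.
Qed.

Lemma indep_code_pair d (D : {vspace 'rV[K]_#|torus K n|}) :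
  (D <= squarefree_code K n d)%VS -> \dim D = 2 ->
  exists c1 c2, [/\ degree_le d c1, degree_le d c2, indep c1 c2
                   & (#|supp2 c1 c2| <= #|chi D|)%N].
Proof.
move=> DC D2.
have [v1 [v2 [v1D v2D fr]]] : exists v1 v2, [/\ v1 \in D, v2 \in D & free [:: v1; v2]].
  have := basis_free (vbasisP D); have := size_tuple (vbasis D).
  have h v : v \in tval (vbasis D) -> v \in D by apply: vbasis_mem.
  case: (tval (vbasis D)) h => [|v1 [|v2 [|? ?]]] h; rewrite D2 // => _ fr.
  by exists v1, v2; split; rewrite ?h ?inE ?eqxx ?orbT.
have [c1 c1d v1E] := squarefree_code_eval (subvP DC _ v1D).
have [c2 c2d v2E] := squarefree_code_eval (subvP DC _ v2D).
exists c1, c2; split => //.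
  (* Evaluation is linear, so a relation between the coefficients is one between the codewords [v1]
     and [v2]. *)
  move=> x y xy0.
  have v0 : x *: v1 + y *: v2 = 0.
    apply/rowP => i; rewrite v1E v2E !mxE -sqf_eval_lin xy0.
    by rewrite /sqf_eval big1 // => A _; rewrite ffunE mul0r.
  move: fr; rewrite free_cons seq1_free span_seq1 => /andP[v1n v2n].
  have x0 : x = 0.
    apply: contraNeq v1n => x0; apply/vlineP; exists (- (y / x)).
    apply: (scalerI x0); rewrite scalerA mulrN mulrCA divff // mulr1 scaleNr.
    by apply/eqP; rewrite -addr_eq0 v0.
  split=> //; move: v0; rewrite x0 scale0r add0r => /eqP.
  by rewrite scaler_eq0 (negPf v2n) orbF => /eqP.
rewrite -(card_imset (mem (chi D)) (@enum_val_inj _ (mem (torus K n)))).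
apply/subset_leq_card/subsetP => P; rewrite inE => /andP[PT nz].
apply/imsetP; exists (enum_rank_in PT P); last by rewrite enum_rankK_in.
rewrite inE; apply/existsP.
case/orP: nz => nz; [exists v1; rewrite v1D v1E|exists v2; rewrite v2D v2E];
  by rewrite mxE /torus_point enum_rankK_in.
Qed.

(** At each of [P1] and [P2] exactly one product is nonzero, which makes the codewords independent;
    every combination vanishes off [W]. *)
Lemma witness_pair d (B1 B2 : {set 'I_n}) y1 y2 P1 P2 (W : {set {ffun 'I_n -> K}}) :
  (#|B1| <= d)%N -> (#|B2| <= d)%N -> P1 \in torus K n -> P2 \in torus K n ->
  shifted_prod B1 y1 P1 != 0 -> shifted_prod B2 y2 P1 = 0 ->
  shifted_prod B1 y1 P2 = 0 -> shifted_prod B2 y2 P2 != 0 ->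
  {in torus K n, forall P,
     (shifted_prod B1 y1 P != 0) || (shifted_prod B2 y2 P != 0) -> P \in W} ->
  exists D : {vspace 'rV[K]_#|torus K n|},
    [/\ (D <= squarefree_code K n d)%VS, \dim D = 2 & (#|chi D| <= #|W|)%N].
Proof.
move=> B1d B2d P1T P2T u1 v1 u2 v2 hW.
pose u := \row_i shifted_prod B1 y1 (torus_point i) : 'rV[K]_#|torus K n|.
pose v := \row_i shifted_prod B2 y2 (torus_point i) : 'rV[K]_#|torus K n|.
have uE P (PT : P \in torus K n) : u 0 (enum_rank_in PT P) = shifted_prod B1 y1 P.
  by rewrite mxE /torus_point enum_rankK_in.
have vE P (PT : P \in torus K n) : v 0 (enum_rank_in PT P) = shifted_prod B2 y2 P.
  by rewrite mxE /torus_point enum_rankK_in.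
exists <<[:: u; v]>>%VS; split.
- by rewrite span_cons span_seq1 subv_add -!memvE !shifted_prod_in_code.
- have /eqP -> // : free [:: u; v].
  rewrite free_cons seq1_free span_seq1; apply/andP; split; last first.
    by apply: contraNneq v2 => v0; rewrite -(vE _ P2T) v0 mxE.
  apply: contraNN u1 => /vlineP[k uk].
  by rewrite -(uE _ P1T) uk mxE vE v1 mulr0.
rewrite -(card_imset (mem (chi _)) (@enum_val_inj _ (mem (torus K n)))).
apply/subset_leq_card/subsetP => _ /imsetP[i + ->].
rewrite inE => /existsP[a /andP[aD ai]]; apply: hW; first exact: enum_valP.
move: aD; rewrite span_cons span_seq1.
case/memv_addP => _ /vlineP[k ->] [_ /vlineP[l ->] aE].
move: ai; rewrite aE !mxE -/(torus_point i).
have [->|//] := eqVneq (shifted_prod B1 y1 (torus_point i)) 0.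
have [->|//] := eqVneq (shifted_prod B2 y2 (torus_point i)) 0.
by rewrite !mulr0 addr0 eqxx.
Qed.

Lemma ghw2_lb m d (D : {vspace 'rV[K]_#|torus K n|}) :
  #|K| = m.+2 -> (D <= squarefree_code K n d)%VS -> \dim D = 2 ->
  (m ^ d * m.+2 * m.+1 ^ n <= m.+1 ^ d.+1 * #|chi D|)%N /\
  (m ^ n.-1 * m.+1 ^ n <= m.+1 ^ n.-1 * #|chi D|)%N.
Proof.
move=> cardK DC /(indep_code_pair DC)[c1 [c2 [c1d c2d ind ND]]]; split.
  apply: leq_trans (supp2_lb_degree cardK c1d c2d ind) _.
  by rewrite leq_mul2l ND orbT.
have VT c : vars_in [set: 'I_n] c by move=> A _; rewrite subsetT.
have Vn : (#|[set: 'I_n]| <= n.-1.+1)%N by rewrite cardsT card_ord leqSpred.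
apply: leq_trans (supp2_lb_vars cardK Vn (VT c1) (VT c2) ind) _.
by rewrite leq_mul2l ND orbT.
Qed.

(** * Planes attaining the bounds *)

Lemma third_elt : (2 < #|K|)%N -> exists2 x : K, x != 0 & x != 1.
Proof.
move=> K3; have : (0 < #|~: [set 0%R; 1%R : K]|)%N.
  by rewrite cardsCs setCK cards2 subn_gt0 (leq_ltn_trans _ K3) // ltnS leq_b1.
by case/card_gt0P => x; rewrite !inE negb_or => /andP[x0 x1]; exists x.
Qed.

Lemma ghw2_witness_full m : #|K| = m.+2 -> (0 < m)%N -> (0 < n)%N ->
  exists D : {vspace 'rV[K]_#|torus K n|},
    [/\ (D <= squarefree_code K n n)%VS, \dim D = 2 & (#|chi D| <= m ^ n.-1 * m.+1)%N].
Proof.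
move=> cardK m0 n0; have [x x0 x1] : exists2 x : K, x != 0 & x != 1.
  by apply: third_elt; rewrite cardK.
pose a : 'I_n := Ordinal n0.
(* The two products share the factors t_j - 1 for j other than [a], and differ by t_a - 1 against
   t_a - x. Their joint support leaves the coordinate [a] free. *)
pose y (j : 'I_n) : K := if j == a then x else 1.
have dis0 : [disjoint ~: [set a] & set0] by rewrite -setI_eq0 setI0.
have := card_grid cardK dis0 (y := fun=> 1) (fun=> oner_neq0 _).
rewrite setU0 setCK cards1 expn1 cardsC1 card_ord => <-.
have sT : (#|[set: 'I_n]| <= n)%N by rewrite cardsT card_ord.
apply: (@witness_pair n setT setT (fun=> 1) y [ffun=> x]
  [ffun j => if j == a then 1 else x]) => //.
- by rewrite inE; apply/forallP => j; rewrite ffunE.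
- by rewrite inE; apply/forallP => j; rewrite ffunE; case: ifP; rewrite ?oner_neq0.
- by rewrite shifted_prod_neq0; apply/forall_inP => j _; rewrite ffunE.
- by apply/eqP/prodf_eq0; exists a; rewrite ?inE // ffunE /y eqxx subrr.
- by apply/eqP/prodf_eq0; exists a; rewrite ?inE // ffunE eqxx subrr.
- rewrite shifted_prod_neq0; apply/forall_inP => j _; rewrite ffunE /y.
  by case: ifP => _ //; rewrite eq_sym.
move=> P PT; rewrite !shifted_prod_neq0 in_set PT => h /=; apply/andP; split.
  apply/forall_inP => j; rewrite !inE => ja.
  by case/orP: h => /forall_inP/(_ j (in_setT _)); rewrite // /y (negPf ja).
by apply/forall_inP => j; rewrite inE.
Qed.

Lemma ghw2_witness m d : #|K| = m.+2 -> (0 < m)%N -> (0 < d < n)%N ->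
  exists D : {vspace 'rV[K]_#|torus K n|},
    [/\ (D <= squarefree_code K n d)%VS, \dim D = 2
      & (#|chi D| <= m ^ d * m.+1 ^ (n - d - 1) * m.+2)%N].
Proof.
move=> cardK m0 /andP[d0 dn]; have [x x0 x1] : exists2 x : K, x != 0 & x != 1.
  by apply: third_elt; rewrite cardK.
(* The d - 1 common factors and the two separate ones take d + 1 coordinates, available since d <
   n. *)
have [a [b [B0 [ab aB bB B0d]]]] : exists a b (B0 : {set 'I_n}),
    [/\ a != b, a \notin B0, b \notin B0 & #|B0| = d.-1].
  have : (d.+1 <= #|'I_n|)%N by rewrite card_ord.
  case/card_geqP => -[|a [|b s]] [us ss _]; try by case: d d0 {dn} ss.
  exists a, b, [set j in s]; move: us => /= /and3P[]; rewrite inE negb_or !inE.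
  by move=> /andP[-> ->] -> us; split=> //; rewrite cardsE (card_uniqP us); case: ss => <-.
have ba : b != a by rewrite eq_sym.
have Bad : #|a |: B0| = d by rewrite cardsU1 aB B0d add1n prednK.
have Bbd : #|b |: B0| = d by rewrite cardsU1 bB B0d add1n prednK.
pose y := fun _ : 'I_n => 1 : K.
have y0 j : y j != 0 by rewrite oner_neq0.
have disj : [disjoint b |: B0 & [set a]].
  by rewrite disjoint_sym disjoints1 !inE negb_or ab.
have C1 : #|~: (a |: B0 :|: set0)| = (n - d)%N by rewrite setU0 cardsCs setCK card_ord Bad.
have C2 : #|~: (b |: B0 :|: [set a])| = (n - d - 1)%N.
  rewrite cardsCs setCK card_ord setUC cardsU1 Bbd !inE negb_or ab aB /=; lia.
have dis0 : [disjoint a |: B0 & set0] by rewrite -setI_eq0 setI0.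
have g1 := card_grid cardK dis0 y0.
have g2 := card_grid cardK disj y0.
rewrite C1 Bad in g1; rewrite C2 Bbd in g2.
(* The terms count the points where the first product is nonzero, and those with P_a = 1 where the
   second is nonzero. *)
have -> : (m ^ d * m.+1 ^ (n - d - 1) * m.+2
    = m ^ d * m.+1 ^ (n - d) + m ^ d * m.+1 ^ (n - d - 1))%N.
  have -> : (n - d = (n - d - 1).+1)%N by lia.
  by rewrite expnS subn1 /=; nia.
rewrite -g2 -g1.
set W1 := [set _ in _ | _]; set W2 := [set _ in _ | _].
suff [D [DC D2 DW]] : exists D : {vspace 'rV[K]_#|torus K n|},
    [/\ (D <= squarefree_code K n d)%VS, \dim D = 2 & (#|chi D| <= #|W1 :|: W2|)%N].
  by exists D; split => //; apply: leq_trans DW _; rewrite cardsU leq_subr.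
apply: (@witness_pair d (a |: B0) (b |: B0) y y [ffun j => if j == b then 1 else x]
  [ffun j => if j == a then 1 else x]); rewrite ?Bad ?Bbd //.
- by rewrite inE; apply/forallP => j; rewrite ffunE; case: ifP; rewrite ?oner_neq0.
- by rewrite inE; apply/forallP => j; rewrite ffunE; case: ifP; rewrite ?oner_neq0.
- rewrite shifted_prod_neq0; apply/forall_inP => j; rewrite ffunE.
  by have [->|//] := eqVneq j b; rewrite !inE (negPf ba) (negPf bB).
- by apply/eqP/prodf_eq0; exists b; rewrite ?setU11 // ffunE eqxx subrr.
- by apply/eqP/prodf_eq0; exists a; rewrite ?setU11 // ffunE eqxx subrr.
- rewrite shifted_prod_neq0; apply/forall_inP => j; rewrite ffunE.
  by have [->|//] := eqVneq j a; rewrite !inE (negPf ab) (negPf aB).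
move=> P PT; rewrite !shifted_prod_neq0 in_setU [P \in W1]in_set [P \in W2]in_set PT => h /=.
(* At P_a = 1 the first product vanishes, leaving the second. Otherwise either product being nonzero
   makes the common factors nonzero, and hence the first product too. *)
have [Pa|Pa] := eqVneq (P a) 1.
  apply/orP; right; apply/andP; split; last first.
    by apply/forall_inP => j /set1P ->; rewrite Pa.
  by case/orP: h => // /forall_inP/(_ a (setU11 _ _)); rewrite Pa eqxx.
apply/orP; left; apply/andP; split; last by apply/forall_inP => j; rewrite inE.
case/orP: h => // /forall_inP hb; apply/forall_inP => j /setU1P[->//|jB].
by apply: hb; rewrite inE jB orbT.
Qed.

End Codes.

(** * The second weight: the bounds, cleared of powers of q - 1, meet the extremal planes *)

Theorem theorem5p6 (K : finFieldType) (s d : nat)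
    (hs : (1 <= s)%N) (hds : (d <= s)%N) (hq : (3 <= #|K|)%N) (hd : (1 <= d)%N) :
  let q := #|K| in
  is_ghw (squarefree_code K s d) 2
    (if d == s then (q - 2) ^ (s - 1) * (q - 1)
     else (q - 2) ^ d * (q - 1) ^ (s - d - 1) * q)%N.
Proof.
move=> q; pose m := (q - 2)%N; have cardK : #|K| = m.+2 by rewrite /m /q; lia.
have m0 : (0 < m)%N by rewrite /m /q; lia.
have -> : (q - 2)%N = m by []; have -> : (q - 1)%N = m.+1 by rewrite /q cardK; lia.
have -> : q = m.+2 by [].
set w := (if _ then _ else _).
have lb (D : {vspace 'rV[K]_#|torus K s|}) :
    (D <= squarefree_code K s d)%VS -> \dim D = 2 -> (w <= #|chi D|)%N.
  move=> DC D2; have [b1 b2] := ghw2_lb cardK DC D2; rewrite /w.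
  case: eqP => [_|ds].
    rewrite subn1 -(@leq_pmul2l (m.+1 ^ s.-1)) ?expn_gt0 //.
    by apply: leq_trans b2; rewrite -[X in (_ <= _ * _ ^ X)%N](prednK hs) expnS; lia.
  rewrite -(@leq_pmul2l (m.+1 ^ d.+1)) ?expn_gt0 //; apply: leq_trans b1.
  have -> : (m.+1 ^ s = m.+1 ^ d.+1 * m.+1 ^ (s - d - 1))%N.
    by rewrite -expnD; congr (_ ^ _)%N; lia.
  lia.
split=> //.
(* An upper bound on the support is enough here; equality follows from [lb]. *)
have [D [DC D2 Dw]] : exists D : {vspace 'rV[K]_#|torus K s|},
    [/\ (D <= squarefree_code K s d)%VS, \dim D = 2 & (#|chi D| <= w)%N].
  rewrite /w; case: eqP => [->|/eqP ds].
    by rewrite subn1; apply: ghw2_witness_full.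
  by apply: ghw2_witness; rewrite // hd ltn_neqAle ds.
by exists D => //; apply/eqP; rewrite eqn_leq Dw lb.
Qed.
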